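(* Let $A\in\mathbb{R}^{n\times n}$ and $B=\begin{bmatrix}I_m\\0\end{bmatrix}\in\mathbb{R}^{n\times m}$. Suppose that the leader set $\mathcal{L}=[1,m]$ and the follower classes $\mathcal{F}_1,\dots,\mathcal{F}_K$ of the graph $\mathcal{G}(A)$ satisfy the leader–follower assumption described in the context, so that the controllability matrix in $K+1$ steps has the block form $$\mathcal{R}_{K+1}=[\,B\;|\;AB\;|\;A^2B\;|\;\cdots\;|\;A^KB\,]=\begin{bmatrix} I_m & * & * & \cdots & *\\ 0&\Phi_1&*&\cdots&*\\ 0&0&\Phi_2&\cdots&*\\ \vdots&\vdots&\vdots&\ddots&\vdots\\ 0&0&0&\cdots&\Phi_K\end{bmatrix},$$ with row blocks of sizes $m,m_1,\dots,m_K$ and $\Phi_k\in\mathbb{R}^{m_k\times m}$, and suppose that every matrix $\Phi_k$, $k\in[1,K]$, has no zero rows. For every $k\in[1,K]$ define $$J_k:=\{j\in[1,m]:\Phi_k\mathbf{e}_j\text{ is unisigned}\},\qquad \mathcal{H}_k:=\bigcup_{j\in J_k}\overline{\mathrm{ZP}}(\Phi_k\mathbf{e}_j).$$ Suppose that for every $k\in[1,K]$ and every $h\in[1,m_k]\setminus\mathcal{H}_k$ there exists $i\in[1,m]\setminus J_k$ such that: (i) $[\Phi_k]_{hi}\neq0$; and (ii) for every $\ell\in[1,m_k]\setminus\mathcal{H}_k$, the condition $[\Phi_k]_{\ell i}\neq0$ implies $\mathrm{sign}([\Phi_k]_{\ell i})=\mathrm{sign}([\Phi_k]_{hi})$. Then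 the pair $(A,B)$ is herdable.
   Context: For integers $k\le n$, $[k,n]$ denotes the integer set $\{k,\dots,n\}$. $[M]_{ij}$ is the $(i,j)$ entry of $M$, and $\mathbf{e}_j$ is the $j$-th canonical basis vector, so $M\mathbf{e}_j$ is the $j$-th column of $M$. For a vector $\mathbf{v}$, $\overline{\mathrm{ZP}}(\mathbf{v})=\{i:[\mathbf{v}]_i\neq 0\}$. A nonzero vector is unisigned if all its nonzero entries have the same sign (the zero vector is not unisigned). In the displayed block matrix $*$ denotes blocks whose values are not relevant. Graph: $\mathcal{G}(A)$ is the signed weighted directed graph with vertex set $[1,n]$ and an arc $(j,i)$ from $j$ to $i$, of weight $[A]_{ij}$, if and only if $[A]_{ij}\neq0$. The distance $d(j,i)$ is the minimal length of a walk from $j$ to $i$, and $d(\mathcal{L},j)=\min_{i\in\mathcal{L}}d(i,j)$. Leader–follower assumption: the leaders are $\mathcal{L}=[1,m]$ and the followers are $\mathcal{F}=[m+1,n]$. For $k\ge1$ let $\mathcal{F}_k=\{j\in\mathcal{F}:d(\mathcal{L},j)=k\}$ and $m_k=|\mathcal{F}_k|$. It is assumed that every follower has finite distance from $\mathcal{L}$, that $K$ is the maximum such distance ($\mathcal{F}_K\neq\emptyset$ and $\mathcal{F}_k=\emptyset$ for $k>K$), and that the followers are ordered so that $\mathcal{F}_1=[m+1,m+m_1]$, and in general $\mathcal{F}_k=[m+m_1+\cdots+m_{k-1}+1,\,m+m_1+\cdots+m_k]$; thus $m+m_1+\cdots+m_K=n$. With this ordering, $\Phi_k$ is the block of $A^kB$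 formed by the rows indexed by $\mathcal{F}_k$. Herdability: the pair $(A,B)$ describes the linear time-invariant system $\dot{\mathbf{x}}(t)=A\mathbf{x}(t)+B\mathbf{u}(t)$ (or its discrete-time counterpart $\mathbf{x}(t+1)=A\mathbf{x}(t)+B\mathbf{u}(t)$). The pair is (completely) herdable if for every $\mathbf{x}(0)$ and every $h>0$ there exist a time $t_f>0$ and an input $\mathbf{u}(t)$, $t\in[0,t_f)$, driving the state from $\mathbf{x}(0)$ to some $\mathbf{x}(t_f)\ge h\mathbf{1}_n$ (entrywise, $\mathbf{1}_n$ the all-ones vector). It is known that (in both continuous and discrete time) this is equivalent to the image (column space) of the controllability matrix $[B\,|\,AB\,|\,\cdots\,|\,A^{n-1}B]$ containing a vector all of whose entries are positive. *)

(* Defs.v *)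
From HB Require Import structures.
From mathcomp Require Import all_boot all_order all_algebra.
From mathcomp Require Import all_classical all_reals all_analysis.

Set Implicit Arguments.
Unset Strict Implicit.
Unset Printing Implicit Defensive.

Import Order.TTheory GRing.Theory Num.Theory.
Import numFieldNormedType.Exports.

Local Open Scope classical_set_scope.
Local Open Scope ring_scope.

Section Graph.
Variables (R : realType) (n : nat) (A : 'M[R]_n).

(* Vertices are numbered from 0. The arc goes from column to row index. *)
Definition graph_arc : rel 'I_n := fun j i => A i j != 0.

Definition walk (k : nat) (j i : 'I_n) : bool :=
  [exists p : k.-tuple 'I_n, path graph_arc j p && (last j p == i)].

(* dist_is j i d means d(j, i) = d < oo; no d satisfies it when there is no
   walk from j to i. *)
Definition dist_is (j i : 'I_n) (d : nat) : bool :=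
  walk d j i && [forall l : 'I_d, ~~ walk l j i].

Definition set_dist_is (L : {set 'I_n}) (j : 'I_n) (d : nat) : bool :=
  [exists i in L, dist_is i j d] &&
  [forall i in L, forall l : 'I_d, ~~ dist_is i j l].

Variable m : nat.

Definition leaders : {set 'I_n} := [set i : 'I_n | (i < m)%N].
Definition followers : {set 'I_n} := [set i : 'I_n | (m <= i)%N].

Definition follower_class (k : nat) : {set 'I_n} :=
  [set j in followers | set_dist_is leaders j k].

(* As followers have positive distance from the leaders, classK_neq0 forces
   0 < K. *)
Record leader_follower (K : nat) : Prop := LeaderFollower {
  follower_reachable : forall j, j \in followers ->
    exists k, set_dist_is leaders j k;
  classK_neq0 : follower_class K != finset.set0;
  class_gtK : forall k, (K < k)%N -> follower_class k = finset.set0;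
  class_ordered : forall k, (1 <= k <= K)%N -> forall i : 'I_n,
    (i \in follower_class k) =
    (m + \sum_(1 <= l < k) #|follower_class l| <= i
       < m + \sum_(1 <= l < k.+1) #|follower_class l|)%N
}.

(* enum_val lists the elements of a set of ordinals in increasing order. *)
Definition Phi (B : 'M[R]_(n, m)) (k : nat) :
    'M[R]_(#|follower_class k|, m) :=
  rowsub (@enum_val _ (mem (follower_class k))) (A ^+ k *m B).

End Graph.

Section SignPatterns.
Variables (R : realType) (p : nat).

Definition nonzero_support (v : 'cV[R]_p) : {set 'I_p} :=
  [set i | v i 0 != 0].

Definition unisigned (v : 'cV[R]_p) : bool :=
  (v != 0) &&
  [forall i in nonzero_support v, forall j in nonzero_support v,
    Num.sg (v i 0) == Num.sg (v j 0)].

Definition unisigned_cols (m : nat) (M : 'M[R]_(p, m)) : {set 'I_m} :=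
  [set j | unisigned (col j M)].

Definition unisigned_rows (m : nat) (M : 'M[R]_(p, m)) : {set 'I_p} :=
  \bigcup_(j in unisigned_cols M) nonzero_support (col j M).

End SignPatterns.

Section Herdability.
Variables (R : realType) (n m : nat) (A : 'M[R]_n) (B : 'M[R]_(n, m)).

(* A classical solution of x' = A x + B u on [0, tf], for a continuous input.
   Continuity and differentiability are expressed coordinatewise. *)
Definition ct_trajectory (tf : R) (u : R -> 'cV[R]_m) (x : R -> 'cV[R]_n) :
    Prop :=
  [/\ forall j, {within `[0, tf], continuous (fun s : R => u s j 0)},
      forall i, {within `[0, tf], continuous (fun s : R => x s i 0)} &
      forall (t : R) i, 0 < t < tf ->
        is_derive t (1 : R) (fun s : R => x s i 0)
          ((A *m x t + B *m u t) i 0)].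

Definition ct_herdable : Prop :=
  forall (x0 : 'cV[R]_n) (h : R), 0 < h ->
  exists (tf : R) (u : R -> 'cV[R]_m) (x : R -> 'cV[R]_n),
    [/\ 0 < tf, ct_trajectory tf u x, x 0 = x0 & forall i, h <= x tf i 0].

Definition dt_trajectory (tf : nat) (u : nat -> 'cV[R]_m)
    (x : nat -> 'cV[R]_n) : Prop :=
  forall t, (t < tf)%N -> x t.+1 = A *m x t + B *m u t.

Definition dt_herdable : Prop :=
  forall (x0 : 'cV[R]_n) (h : R), 0 < h ->
  exists (tf : nat) (u : nat -> 'cV[R]_m) (x : nat -> 'cV[R]_n),
    [/\ (0 < tf)%N, dt_trajectory tf u x, x 0%N = x0 &
        forall i, h <= x tf i 0].

End Herdability.

(* Main.v *)
Require Import Defs.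
From mathcomp Require Import all_boot all_order all_algebra.
From mathcomp Require Import all_classical all_reals all_analysis.
From mathcomp Require Import ring.

Import Order.TTheory GRing.Theory Num.Theory.
Import numFieldNormedType.Exports.

Set Implicit Arguments.
Unset Strict Implicit.
Unset Printing Implicit Defensive.

Local Open Scope ring_scope.

(** The sign conditions produce, for each follower class, an input direction
under which that class is strictly positive; the block triangular shape of the
controllability matrix glues these directions into one positive reachable
vector; and a positive vector reachable from 0 can be scaled to beat any free
motion of the system.

Signs ([positive_combination]).  Give each unisigned column of Phi_k the sign
of its entries: the combination is nonnegative everywhere and positive on the
rows H_k that these columns meet.  Outside H_k the unisigned columns vanish,
and the columns provided by the herdability condition have a constant sign
there, so the same recipe restricted to those rows gives a combination
positive on the complement of H_k, of unknown sign on H_k.  A large multiple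
of the first combination plus the second one is positive on all rows.

Gluing ([controllability_positive]).  A nonzero entry (i, j) of A^k is
witnessed by a walk of length k from j to i, so the rows of A^k B at distance
more than k from the leaders vanish.  Starting from the farthest class and
going down to the leaders, one adds a large multiple of the input direction of
the current class: this makes the class positive and leaves the farther
classes untouched.  The argument only uses that the reachable vectors form a
linear set containing all the A^k B w with k <= K, so that it applies to both
kinds of time.

Discrete time.  In K+1 steps an impulse at time K-k reaches A^k B w
([dt_reach_power]), hence some input reaches a positive vector, and scaling it
beats the free motion ([dt_reach_herdable]).

Continuous time.  Reachability from 0 is obtained with polynomial trajectories
only, by the usual differential parametrization of the controllable subspace.
Let p be a monic polynomial with p(A) = 0.  As p(X) - p(A) is divisible by
X - A, with quotient the sum of the A^k p_k(X), where p_k is p shifted down by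
k+1 coefficients, every polynomial y gives a solution of x' = A x + B u, namely
x = sum of the p_k(d/dt) y A^k B w with u = p(d/dt) y w.  Choosing the
derivatives of y at 0 and 1 by Hermite interpolation yields a trajectory from
0 to A^r B w plus lower powers, and induction on r gives [poly_reach_power].
The uncontrolled motion from an arbitrary initial state is the exponential
series of t A applied to that state ([is_derive_free_motion]).  Adding it to a
large multiple of a polynomial trajectory from 0 to a positive vector proves
herdability ([poly_reach_herdable]). *)

(** * Sign patterns *)

Lemma large_multiple (R : realFieldType) (I : finType) (P : pred I)
    (f g : I -> R) :
  (forall i, P i -> 0 < f i) ->
  exists2 c, 0 <= c & forall i, P i -> g i < c * f i.
Proof.
move=> f_gt0.
have ratio_ge0 i : P i -> 0 <= `|g i| / f i.
  by move=> Pi; rewrite divr_ge0 // ltW // f_gt0.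
exists (1 + \sum_(i | P i) `|g i| / f i).
  by rewrite addr_ge0 // sumr_ge0.
move=> i Pi; rewrite -ltr_pdivrMr ?f_gt0 //.
rewrite (bigD1 i) //= (@le_lt_trans _ _ (`|g i| / f i)) //.
  by rewrite ler_pM2r ?invr_gt0 ?f_gt0 // ler_norm.
rewrite addrCA ltrDl ltr_pwDl // sumr_ge0 // => j /andP[Pj _].
exact: ratio_ge0.
Qed.

Lemma eq_sg_mulr_ge0 (R : realDomainType) (a b : R) :
  (a != 0 -> b != 0 -> Num.sg a = Num.sg b) -> 0 <= a * b.
Proof.
move=> sg_ab; have [->|a0] := eqVneq a 0; first by rewrite mul0r.
have [->|b0] := eqVneq b 0; first by rewrite mulr0.
by rewrite -sgr_ge0 sgrM (sg_ab a0 b0) -expr2 sqr_ge0.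
Qed.

(** Weight each selected column by the sum of its entries in S: on S this weight
has the sign of all the entries of the column, hence every term of a row sum is
nonnegative, and positive as soon as the entry is nonzero. *)
Lemma coherent_columns (R : realFieldType) (p m : nat) (M : 'M[R]_(p, m))
    (S : {set 'I_p}) (Q : pred 'I_m) :
  (forall j, Q j -> {in S &, forall h l, 0 <= M h j * M l j}) ->
  exists v : 'cV[R]_m, forall l, l \in S ->
    0 <= (M *m v) l 0 /\
    forall j, Q j -> M l j != 0 -> 0 < (M *m v) l 0.
Proof.
move=> coh.
exists (\col_j (if Q j then \sum_(h in S) M h j else 0)) => l lS.
pose t j := M l j * (if Q j then \sum_(h in S) M h j else 0).
have -> : (M *m \col_j (if Q j then \sum_(h in S) M h j else 0)) l 0 =
    \sum_j t j by rewrite mxE; apply: eq_bigr => j _; rewrite mxE.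
have t_ge0 j : 0 <= t j.
  rewrite /t; case: ifP => [Qj|_]; last by rewrite mulr0.
  by rewrite mulr_sumr sumr_ge0 // => h hS; exact: coh.
split=> [|j Qj Mlj]; first exact: sumr_ge0.
rewrite (bigD1 j) //= ltr_pwDl ?sumr_ge0 // /t Qj (bigD1 l) //= mulrDr.
rewrite ltr_pwDl ?mulr_sumr ?sumr_ge0 //.
  by rewrite -expr2 exprn_even_gt0.
by move=> h /andP[hS _]; exact: coh.
Qed.

Lemma scale_addmxE (R : pzRingType) (p m : nat) (c : R) (M N : 'M[R]_(p, m)) i j :
  (c *: M + N) i j = c * M i j + N i j.
Proof. by rewrite mxE [X in X + _]mxE. Qed.

(** The unisigned columns dominate on the rows that they meet and vanish on the
other rows, where the sign-coherent columns take over. *)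
Lemma positive_combination (R : realType) (p m : nat) (M : 'M[R]_(p, m)) :
  (forall h, h \notin unisigned_rows M ->
     exists i, [/\ i \notin unisigned_cols M, M h i != 0 &
       forall l, l \notin unisigned_rows M -> M l i != 0 ->
         Num.sg (M l i) = Num.sg (M h i)]) ->
  exists v : 'cV[R]_m, forall h, 0 < (M *m v) h 0.
Proof.
move=> herd.
have cohJ j : j \in unisigned_cols M ->
    {in [set: 'I_p] &, forall h l, 0 <= M h j * M l j}.
  rewrite inE => /andP[_ /forall_inP uni] h l _ _.
  apply: eq_sg_mulr_ge0 => hj lj.
  have /uni/forall_inP : h \in nonzero_support (col j M) by rewrite inE mxE.
  by move=> /(_ l); rewrite inE !mxE => /(_ lj)/eqP.
have [v v_pos] := coherent_columns cohJ.
pose S := ~: unisigned_rows M.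
(* All columns that are sign-coherent on S may be used at once; a single
   witness of herdability per row shows that they cover S. *)
pose Q i := [forall h in S, forall l in S, 0 <= M h i * M l i].
have cohQ i : Q i -> {in S &, forall h l, 0 <= M h i * M l i}.
  by move=> /forall_inP Qi h l /Qi/forall_inP; apply.
have [w w_pos] := coherent_columns cohQ.
have v_gt0 h : h \in unisigned_rows M -> 0 < (M *m v) h 0.
  move=> /bigcupP[j jJ]; rewrite inE mxE => Mhj.
  by have [_] := v_pos h (finset.in_setT h); apply; first exact: jJ.
have [c c_ge0 c_large] := large_multiple (fun h => - (M *m w) h 0) v_gt0.
exists (c *: v + w) => h; rewrite mulmxDr -scalemxAr scale_addmxE.
have [hH|hH] := boolP (h \in unisigned_rows M).
  by have := c_large h hH; rewrite -subr_gt0 opprK.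
have hS : h \in S by rewrite inE.
have [i [_ Mhi sg_i]] := herd h hH.
rewrite ltr_wpDl //.
  by rewrite mulr_ge0 //; have [] := v_pos h (finset.in_setT h).
have [_] := w_pos h hS; apply; last exact: Mhi.
apply/forall_inP => a; rewrite inE => aS; apply/forall_inP => b; rewrite inE => bS.
by apply: eq_sg_mulr_ge0 => Mai Mbi; rewrite !sg_i.
Qed.

(** * Gluing the follower classes *)

Definition linear_set (R : pzRingType) (n : nat) (V : 'cV[R]_n -> Prop) : Prop :=
  V 0 /\ forall (c : R) x y, V x -> V y -> V (c *: x + y).

Lemma linear_set_sum (R : pzRingType) (n : nat) (V : 'cV[R]_n -> Prop)
    (I : Type) (r : seq I) (P : pred I) (c : I -> R) (x : I -> 'cV[R]_n) :
  linear_set V -> (forall i, P i -> V (x i)) ->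
  V (\sum_(i <- r | P i) c i *: x i).
Proof.
move=> [V0 VD] Vx; elim/big_rec: _ => // i y Pi Vy.
by apply: VD => //; exact: Vx.
Qed.

(** Levels are treated from K downwards: a large multiple of M_k v, which
vanishes on the levels above k, repairs level k whatever has been added so
far. *)
Lemma triangular_positive (R : realType) (n m K : nat)
    (M : nat -> 'M[R]_(n, m)) (lev : 'I_n -> nat) (V : 'cV[R]_n -> Prop) :
  linear_set V ->
  (forall k w, (k <= K)%N -> V (M k *m w)) ->
  (forall i, (lev i <= K)%N) ->
  (forall k i j, (k < lev i)%N -> M k i j = 0) ->
  (forall k, (k <= K)%N ->
     exists v : 'cV_m, forall i, lev i = k -> 0 < (M k *m v) i 0) ->
  exists z, V z /\ forall i, 0 < z i 0.
Proof.
move=> [V0 VD] VM lev_le M_tri M_pos.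
suff claim d : (d <= K.+1)%N ->
    exists z, V z /\ forall i, (K.+1 - d <= lev i)%N -> 0 < z i 0.
  have [z [Vz z_pos]] := claim K.+1 (leqnn _).
  by exists z; split=> // i; apply: z_pos; rewrite subnn.
elim: d => [_|d IHd dK].
  exists 0; split=> // i; rewrite subn0 => lev_gt.
  by have := lev_le i; rewrite leqNgt lev_gt.
have [z [Vz z_pos]] := IHd (ltnW dK).
pose k := (K - d)%N.
have kK : (k <= K)%N by exact: leq_subr.
have [v v_pos] := M_pos k kK.
have v_posb i : lev i == k -> 0 < (M k *m v) i 0 by move=> /eqP; exact: v_pos.
have [c _ c_large] := large_multiple (fun i => - z i 0) v_posb.
exists (c *: (M k *m v) + z); split=> [|i]; first by apply: VD => //; exact: VM.
rewrite subSS -/k leq_eqVlt scale_addmxE => /orP[/eqP lev_i|k_lt].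
  by have := c_large i; rewrite -lev_i eqxx -subr_gt0 opprK; apply.
have -> : (M k *m v) i 0 = 0.
  by rewrite mxE big1 // => j _; rewrite M_tri ?mul0r.
by rewrite mulr0 add0r z_pos // subSn.
Qed.

Lemma walk_of_expmx (R : realType) (n : nat) (A : 'M[R]_n) k (i j : 'I_n) :
  (A ^+ k) i j != 0 -> walk A k j i.
Proof.
elim: k i => [|k IHk] i.
  rewrite expr0 mxE pnatr_eq0 eqb0 negbK => /eqP ->.
  by apply/existsP; exists [tuple]; rewrite /= eqxx.
rewrite exprS mxE => /eqP /eqP.
have [[l]|all0] := pselect (exists l, A i l * (A ^+ k) l j != 0).
  rewrite mulf_eq0 negb_or => /andP[Ail /IHk/existsP[p /andP[jp /eqP lp]]] _.
  apply/existsP; exists [tuple of rcons p i].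
  by rewrite /= rcons_path jp last_rcons eqxx lp /= /graph_arc Ail.
case/negP; apply/eqP/big1 => l _; apply/eqP/negPn/negP => Al.
by apply: all0; exists l.
Qed.

(** A distance is the length of a shortest walk, so any walk bounds it: the
walk yields an exact distance at most its own length. *)
Lemma set_dist_le_walk (R : realType) (n : nat) (A : 'M[R]_n)
    (L : {set 'I_n}) (i j : 'I_n) (d k : nat) :
  set_dist_is A L j d -> i \in L -> walk A k i j -> (d <= k)%N.
Proof.
move=> /andP[_ /forall_inP dmin] iL wk; rewrite leqNgt; apply/negP => kd.
have exw : exists k, walk A k i j by exists k.
case: (ex_minnP exw) => e we e_min.
have ed : (e < d)%N by exact: leq_ltn_trans (e_min k wk) kd.
have /forallP/(_ (Ordinal ed))/negP := dmin i iL; apply.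
rewrite /dist_is we; apply/forallP => l; apply/negP => /e_min.
by rewrite leqNgt ltn_ord.
Qed.

(** The levels of [triangular_positive] are the distances from the leaders, the
leaders themselves being at level 0, where B is an identity block. *)
Lemma controllability_positive (R : realType) (n m K : nat) (A : 'M[R]_n)
    (B : 'M[R]_(n, m)) (V : 'cV[R]_n -> Prop) :
  (m <= n)%N -> B = pid_mx m -> leader_follower A m K ->
  (forall k, (1 <= k <= K)%N ->
     exists v : 'cV_m, forall h, 0 < (Phi A B k *m v) h 0) ->
  linear_set V ->
  (forall k w, (k <= K)%N -> V (A ^+ k *m B *m w)) ->
  exists z, V z /\ forall i, 0 < z i 0.
Proof.
move=> mn defB lf Phi_pos linV VAB.
have /choice[lev lev_dist] i : exists d, set_dist_is A (leaders n m) i d.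
  have [im|mi] := ltnP i m; last first.
    by apply: (follower_reachable lf); rewrite inE.
  exists 0%N; apply/andP; split; last first.
    by apply/forall_inP => ? _; apply/forallP => -[].
  apply/exists_inP; exists i; first by rewrite inE.
  apply/andP; split; last by apply/forallP => -[].
  by apply/existsP; exists [tuple]; rewrite /= eqxx.
have lev0 (i : 'I_n) : (i < m)%N -> lev i = 0%N.
  move=> im; apply/eqP; rewrite -leqn0.
  apply: (set_dist_le_walk (i := i) (lev_dist i)); first by rewrite inE.
  by apply/existsP; exists [tuple]; rewrite /= eqxx.
have lev_class (i : 'I_n) : (m <= i)%N -> i \in follower_class A m (lev i).
  by move=> mi; rewrite 2!inE mi; exact: lev_dist.
have lev_gt0 (i : 'I_n) : (m <= i)%N -> (0 < lev i)%N.
  move=> mi; rewrite lt0n; apply/eqP => lev_i0.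
  have := lev_dist i; rewrite lev_i0 => /andP[/exists_inP[l]].
  rewrite inE => lm /andP[/existsP[p /andP[_]]].
  by rewrite (tuple0 p) /= => /eqP li; rewrite li ltnNge mi in lm.
apply: (@triangular_positive _ _ _ K (fun k => A ^+ k *m B) lev) => //.
- move=> i; have [im|mi] := ltnP i m; first by rewrite lev0.
  rewrite leqNgt; apply/negP => /(class_gtK lf) class0.
  by have := lev_class i mi; rewrite class0 inE.
- move=> k i j k_lt; rewrite defB mxE big1 // => l _.
  rewrite mxE; have [lj|] /= := eqVneq (l : nat) j; last by rewrite mulr0.
  have lL : l \in leaders n m by rewrite inE lj.
  apply/eqP; rewrite mulf_eq0; apply/orP; left; apply/negPn/negP.
  move=> /walk_of_expmx/(set_dist_le_walk (lev_dist i) lL).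
  by rewrite leqNgt k_lt.
move=> k kK; have [k0|k_gt0] := posnP k.
  exists (const_mx 1) => i; rewrite k0 expr0 mul1mx => lev_i0.
  have im : (i < m)%N.
    by rewrite ltnNge; apply/negP => /lev_gt0; rewrite lev_i0.
  rewrite defB mxE (bigD1 (Ordinal im)) //= !mxE /= eqxx im mulr1.
  by rewrite ltr_pwDl // sumr_ge0 // => j _; rewrite !mxE mulr1 ler0n.
have [|v v_pos] := Phi_pos k; first by rewrite k_gt0.
exists v => i lev_i.
have mi : (m <= i)%N.
  by rewrite leqNgt; apply/negP => /lev0; rewrite lev_i => k0; rewrite k0 in k_gt0.
have i_class : i \in follower_class A m k by rewrite -lev_i lev_class.
have := v_pos (enum_rank_in i_class i).
rewrite /Phi mxE; under eq_bigr do rewrite mxE enum_rankK_in //.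
by rewrite [X in _ -> 0 < X]mxE.
Qed.

(** * Discrete time *)

Definition dt_reach (R : realType) (n m : nat) (A : 'M[R]_n) (B : 'M[R]_(n, m))
    (T : nat) (z : 'cV[R]_n) : Prop :=
  exists u x, [/\ dt_trajectory A B T u x, x 0%N = 0 & x T = z].

Section DiscreteTime.
Variables (R : realType) (n m : nat) (A : 'M[R]_n) (B : 'M[R]_(n, m)) (T : nat).

Lemma dt_trajectory_comb c u1 x1 u2 x2 :
  dt_trajectory A B T u1 x1 -> dt_trajectory A B T u2 x2 ->
  dt_trajectory A B T (fun t => c *: u1 t + u2 t) (fun t => c *: x1 t + x2 t).
Proof.
move=> traj1 traj2 t tT; rewrite traj1 // traj2 // !mulmxDr -!scalemxAr scalerDr.
by rewrite addrACA.
Qed.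

Lemma linear_dt_reach : linear_set (dt_reach A B T).
Proof.
split; first by exists (fun=> 0), (fun=> 0); split=> // t _; rewrite !mulmx0 addr0.
move=> c _ _ [u1 [x1 [traj1 x10 <-]]] [u2 [x2 [traj2 x20 <-]]].
exists (fun t => c *: u1 t + u2 t), (fun t => c *: x1 t + x2 t).
by split=> //; [exact: dt_trajectory_comb | rewrite x10 x20 scaler0 addr0].
Qed.

(** An impulse w at time s = T - k - 1 has k steps left to evolve. *)
Lemma dt_reach_power k w : (k < T)%N -> dt_reach A B T (A ^+ k *m B *m w).
Proof.
move=> kT; pose s := (T - k.+1)%N.
exists (fun t => if t == s then w else 0).
exists (fun t => if (t <= s)%N then 0 else A ^+ (t - s.+1) *m B *m w).
split=> [t _||] //; last first.
  by rewrite /s leqNgt ltn_subrL (leq_ltn_trans _ kT) //= -subSn // subSS subKn // ltnW.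
have [ts|st|->] := ltngtP t s.
- by rewrite !mulmx0 addr0.
- by rewrite mulmx0 addr0 subSn // exprS -!mulmxA.
- by rewrite subnn expr0 mul1mx mulmx0 add0r.
Qed.

Lemma dt_reach_herdable z :
  (0 < T)%N -> dt_reach A B T z -> (forall i, 0 < z i 0) -> dt_herdable A B.
Proof.
move=> T_gt0 [u [x [traj x0 xT]]] z_pos a h _.
have [c _ c_large] := large_multiple (P := xpredT)
  (fun i => h - (A ^+ T *m a) i 0) (fun i _ => z_pos i).
have free : dt_trajectory A B T (fun=> 0) (fun t => A ^+ t *m a).
  by move=> t _; rewrite mulmx0 addr0 exprS mulmxA.
exists T, (fun t => c *: u t + 0), (fun t => c *: x t + A ^+ t *m a); split=> //.
- exact: dt_trajectory_comb.
- by rewrite x0 scaler0 add0r expr0 mul1mx.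
by move=> i; rewrite xT scale_addmxE -lerBlDr ltW // c_large.
Qed.

End DiscreteTime.

(** * Polynomial trajectories in continuous time *)

Section PolynomialSteering.
Variables (R : realType) (n m : nat) (A : 'M[R]_n) (B : 'M[R]_(n, m)).

(** Restricting to polynomial inputs and states on [0, 1] turns the differential
equation into an identity between formal derivatives. *)
Definition poly_reach (z : 'cV[R]_n) : Prop :=
  exists (x : 'I_n -> {poly R}) (u : 'I_m -> {poly R}),
    [/\ forall i, (x i)^`() = \sum_j A i j *: x j + \sum_j B i j *: u j,
        forall i, (x i).[0] = 0 & forall i, (x i).[1] = z i 0].

Lemma linear_poly_reach : linear_set poly_reach.
Proof.
split.
  exists (fun=> 0), (fun=> 0); split=> i; rewrite ?horner0 ?mxE // deriv0.
  by rewrite !big1 ?addr0 // => j _; rewrite scaler0.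
move=> c z1 z2 [x1 [u1 [dx1 x10 x1z]]] [x2 [u2 [dx2 x20 x2z]]].
exists (fun i => c *: x1 i + x2 i), (fun j => c *: u1 j + u2 j); split=> i.
- rewrite derivD derivZ dx1 dx2 scalerDr addrACA !scaler_sumr -!big_split /=.
  by congr (_ + _); apply: eq_bigr => j _; rewrite scalerDr !scalerA mulrC.
- by rewrite !hornerE x10 x20 mulr0 addr0.
- by rewrite !hornerE x1z x2z scale_addmxE.
Qed.

(** The differential operator whose symbol is p with its k lowest coefficients
removed and the others shifted down, applied to y.  The indices k + j beyond the
degree contribute 0, which allows one summation range for all k. *)
Definition quotient_deriv (p y : {poly R}) (k : nat) : {poly R} :=
  \sum_(j < size p) p`_(k + j) *: y^`(j).

(** Horner's rule for the symbols: q_k = p_k + X q_(k+1). *)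
Lemma quotient_derivS p y k :
  quotient_deriv p y k = p`_k *: y + (quotient_deriv p y k.+1)^`().
Proof.
rewrite /quotient_deriv; case sz: (size p) => [|N].
  rewrite !big_ord0 deriv0 addr0 nth_default ?scale0r //; by rewrite sz.
rewrite big_ord_recl addn0 derivn0; congr (_ + _).
rewrite [in RHS]big_ord_recr /= nth_default ?sz ?addSn ?ltnS ?leq_addl //.
rewrite scale0r addr0 raddf_sum /=.
by apply: eq_bigr => j _; rewrite derivZ addnS.
Qed.

Lemma quotient_deriv_top p y : p \is monic ->
  quotient_deriv p y (size p).-1 = y.
Proof.
move=> p_monic; have p_gt0 : (0 < size p)%N by rewrite size_poly_gt0 monic_neq0.
rewrite quotient_derivS -lead_coefE (monicP p_monic) scale1r /quotient_deriv.
rewrite prednK // big1 ?deriv0 ?addr0 // => j _.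
by rewrite nth_default ?scale0r // leq_addr.
Qed.

(** The state x with coordinates q_(k+1)(d/dt) y along A^k B w satisfies
x' = A x + B u for u = q_0(d/dt) y w: by Horner's rule x' telescopes against
A x, and what remains is -p(A) B w y = 0. *)
Lemma poly_reach_state (p y : {poly R}) (w : 'cV[R]_m) : p \is monic ->
  \sum_(k < size p) p`_k *: A ^+ k = 0 ->
  (forall j, (j < (size p).-1)%N -> y^`(j).[0] = 0) ->
  poly_reach (\sum_(k < (size p).-1)
    (quotient_deriv p y k.+1).[1] *: (A ^+ k *m B *m w)).
Proof.
move=> p_monic pA0 y0; set N := (size p).-1.
have sz : size p = N.+1 by rewrite prednK // size_poly_gt0 monic_neq0.
pose b k i := (A ^+ k *m B *m w) i 0.
pose Q := quotient_deriv p y.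
have bS k i : b k.+1 i = \sum_j A i j * b k j.
  by rewrite /b exprS -!mulmxA mxE; apply: eq_bigr => j _; rewrite mulmxA.
have b0 i : b 0%N i = \sum_j B i j * w j 0 by rewrite /b expr0 mul1mx mxE.
have b_dep i : \sum_(k < N.+1) p`_k * b k i = 0.
  have := congr1 (fun M : 'M[R]_n => (M *m (B *m w)) i 0) pA0.
  rewrite sz mul0mx [X in _ = X -> _]mxE.
  move=> eq0; rewrite -[RHS]eq0 mulmx_suml summxE.
  by apply: eq_bigr => k _; rewrite -scalemxAl mxE mulmxA.
exists (fun i => \sum_(k < N) b k i *: Q k.+1), (fun j => w j 0 *: Q 0%N).
split=> i; last first.
- rewrite summxE horner_sum; apply: eq_bigr => k _.
  by rewrite hornerZ mxE mulrC.
- rewrite horner_sum big1 // => k _; rewrite hornerZ horner_sum big1 ?mulr0 //.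
  move=> j _; rewrite hornerZ; have [jN|Nj] := ltnP j N; first by rewrite y0 // mulr0.
  by rewrite nth_default ?mul0r // [leqLHS]sz addSn ltnS (leq_trans Nj) ?leq_addl.
have -> : \sum_j B i j *: (w j 0 *: Q 0%N) = b 0%N i *: Q 0%N.
  by rewrite b0 scaler_suml; apply: eq_bigr => j _; rewrite scalerA.
have -> : \sum_j A i j *: (\sum_(k < N) b k j *: Q k.+1) =
    \sum_(k < N) b k.+1 i *: Q k.+1.
  under eq_bigr do rewrite scaler_sumr.
  rewrite exchange_big; apply: eq_bigr => k _; rewrite bS scaler_suml.
  by apply: eq_bigr => j _; rewrite scalerA.
have dQ k : (Q k.+1)^`() = Q k - p`_k *: y.
  by rewrite /Q [in RHS]quotient_derivS addrC addKr.
rewrite raddf_sum /=.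
under eq_bigr => k _ do rewrite derivZ dQ scalerBr.
rewrite sumrB addrC.
have -> : \sum_(k < N) b k.+1 i *: Q k.+1 + b 0%N i *: Q 0%N =
    \sum_(k < N.+1) b k i *: Q k by rewrite big_ord_recl addrC.
rewrite big_ord_recr /= addrC; congr (_ + _).
have -> : Q N = y by exact: quotient_deriv_top.
apply/eqP; rewrite eq_sym -subr_eq0 opprK.
have := b_dep i; rewrite big_ord_recr /= => /(congr1 (fun a => a *: y)).
rewrite scale0r scalerDl scaler_suml => dep; rewrite -[X in _ == X]dep.
apply/eqP; rewrite addrC; congr (_ + _).
  by apply: eq_bigr => k _; rewrite scalerA mulrC.
have -> : p`_N = 1 by rewrite -(monicP p_monic) lead_coefE.
by rewrite mul1r.
Qed.

End PolynomialSteering.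

Lemma derivn_XsubC_exp (R : comNzRingType) (a : R) r j :
  (('X - a%:P) ^+ r)^`(j) = ('X - a%:P) ^+ (r - j) *+ r ^_ j.
Proof.
elim: j => [|j IHj]; first by rewrite subn0 ffactn0.
by rewrite derivnS IHj derivMn deriv_exp derivXsubC mul1r -mulrnA mulnC
  -ffactnSr subnS.
Qed.

(** Each derivation lowers the multiplicity of a root by at most one. *)
Lemma horner_derivn_root_power (R : comNzRingType) (a : R) (q : {poly R}) N j :
  (j < N)%N -> ((q * ('X - a%:P) ^+ N)^`(j)).[a] = 0.
Proof.
elim: j N q => [|j IHj] [|N] q // jN.
  by rewrite derivn0 hornerM horner_exp hornerXsubC subrr expr0n mulr0.
rewrite derivSn derivM deriv_exp derivXsubC mul1r exprSr mulrA mulrnAr -mulrnAl.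
rewrite mulrAC -mulrDl; exact: IHj.
Qed.

(** Bezout's identity u f + v g = 1 for f = X^N and g = (X - 1)^N makes u f
vanish to order N at 0 and agree with 1 to order N at 1; multiplying it by
(X - 1)^r / r! leaves the r-th derivative at 1 as the only nonzero one of order
below N at either point. *)
Lemma hermite_basis (R : numFieldType) (N r : nat) :
  exists y : {poly R}, forall j, (j < N)%N ->
    y^`(j).[0] = 0 /\ y^`(j).[1] = (j == r)%:R.
Proof.
have : coprimep (('X - 0%:P) ^+ N) (('X - 1%:P) ^+ N : {poly R}).
  by apply/coprimep_expl/coprimep_expr/coprimep_XsubC2; rewrite subr0 oner_eq0.
move=> /Bezout_eq1_coprimepP[[u v] /= uv]; set f := _ ^+ N in uv; set g := _ ^+ N in uv.
pose c : R := (r`!%:R)^-1; pose q : {poly R} := ('X - 1%:P) ^+ r.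
exists (c *: (q * u * f)) => j jN; rewrite !derivnZ !hornerZ.
split; first by rewrite horner_derivn_root_power ?mulr0.
have -> : q * u * f = q - q * v * g.
  by rewrite -[X in X - _]mulr1 -uv mulrDr !mulrA addrK.
rewrite derivnB hornerD hornerN horner_derivn_root_power // subr0 derivn_XsubC_exp.
rewrite hornerMn horner_exp hornerXsubC subrr expr0n subn_eq0.
have [rj|jr|rj] := ltngtP r j.
- by rewrite ffact_small // mulr0.
- by rewrite mul0rn mulr0.
- by rewrite rj ffactnn mulr1n /c rj mulVf ?pnatr_eq0 -?lt0n ?fact_gt0.
Qed.

(** The factor X^K only serves to raise the degree above K, so that A^K is among
the powers occurring in the trajectories. *)
Lemma annihilating_poly (R : fieldType) (n K : nat) (A : 'M[R]_n) :
  exists p : {poly R}, [/\ p \is monic, (K < (size p).-1)%N &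
    \sum_(k < size p) p`_k *: A ^+ k = 0].
Proof.
case: n A => [|n] A.
  exists 'X^(K.+1); split; rewrite ?monicXn ?size_polyXn //.
  by apply/matrixP => -[].
have chi_monic := char_poly_monic A.
exists (char_poly A * 'X^K); split; first by rewrite monicMr ?monicXn.
  by rewrite size_mulXn ?monic_neq0 // size_char_poly !addnS ltnS leq_addr.
have : horner_mx A (char_poly A * 'X^K) = 0.
  by rewrite rmorphM /= Cayley_Hamilton mul0r.
rewrite /horner_mx /horner_morph horner_coef size_map_poly.
move=> chi0; rewrite -[RHS]chi0.
by apply: eq_bigr => k _; rewrite coef_map -mul_scalar_mx.
Qed.

(** With the derivative of order N - r - 1 of y at 1 as the only nonzero one below
order N, the
final state is the sum of the p_(k + N - r) A^k B w.  Its terms with k > r vanish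
for degree reasons and the one with k = r has coefficient 1, so A^r B w differs
from it by vectors that are reachable by induction. *)
Lemma poly_reach_power (R : realType) (n m : nat) (A : 'M[R]_n)
    (B : 'M[R]_(n, m)) (k : nat) (w : 'cV[R]_m) :
  poly_reach A B (A ^+ k *m B *m w).
Proof.
have [p [p_monic p_size pA0]] := annihilating_poly k A.
set N := (size p).-1 in p_size.
have sz : size p = N.+1 by rewrite prednK // size_poly_gt0 monic_neq0.
have linV := linear_poly_reach A B.
pose b r := A ^+ r *m B *m w; rewrite -/(b k).
elim/ltn_ind: k p_size => r IHr rN.
have [y y_jet] := hermite_basis R N (N - r.+1).
have Q1 (k : nat) : (quotient_deriv p y k.+1).[1] = p`_(k + (N - r)).
  have jN : (N - r.+1 < N)%N by rewrite ltn_subrL (leq_ltn_trans _ rN).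
  have jN1 : (N - r.+1 < size p)%N by rewrite sz leqW.
  rewrite horner_sum (bigD1 (Ordinal jN1)) //= big1 ?addr0 => [|j jr].
    have [_] := y_jet (N - r.+1)%N jN; rewrite hornerZ eqxx => ->.
    by rewrite mulr1 addSn -addnS subnSK.
  rewrite hornerZ; have [jltN|Nj] := ltnP j N.
    by have [_ ->] := y_jet j jltN; rewrite -val_eqE /= in jr; rewrite (negbTE jr) mulr0.
  by rewrite nth_default ?mul0r // [leqLHS]sz addSn ltnS (leq_trans Nj) ?leq_addl.
have := poly_reach_state B w p_monic pA0 (fun j jN => (y_jet j jN).1).
under eq_bigr do rewrite Q1; rewrite -/N (bigD1 (Ordinal rN)) //=.
rewrite subnKC ?(ltnW rN) // -lead_coefE (monicP p_monic) scale1r -/(b r).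
rewrite (bigID (fun i : 'I_N => (i < r)%N)) /= [X in _ + (_ + X)]big1 ?addr0.
  set rest := \sum_(_ < _ | _) _ => V_sum.
  have V_rest : poly_reach A B rest.
    by apply: (linear_set_sum _ _ linV) => i /andP[_ ir]; exact: IHr.
  have := linV.2 (-1) _ _ V_rest V_sum.
  by rewrite scaleN1r addrCA addNr addr0.
move=> i /andP[ir]; rewrite -leqNgt => ri.
have {ri ir}r_lt : (r < i)%N by rewrite ltn_neqAle eq_sym ri andbT.
by rewrite nth_default ?scale0r // sz -[leqLHS](subnKC (leqW (ltnW rN))) subSn
  ?(ltnW rN) // addnS -addSn leq_add2r.
Qed.

(** * The exponential of a matrix acting on a vector *)

Section FreeMotion.
Variables (R : realType) (n : nat) (A : 'M[R]_n).
Local Open Scope classical_set_scope.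

Definition expmx_coeff (a : 'cV[R]_n) (i : 'I_n) (k : nat) : R :=
  (A ^+ k *m a) i 0 / k`!%:R.

Lemma expmx_coeff_bound (a : 'cV[R]_n) : exists r C : R,
  [/\ 0 <= r, 0 <= C & forall k i, `|(A ^+ k *m a) i 0| <= C * r ^+ k].
Proof.
exists (\sum_i \sum_j `|A i j|), (\sum_i `|a i 0|).
have r_ge0 : 0 <= \sum_i \sum_j `|A i j| by do 2!apply: sumr_ge0 => ? _.
split=> //; first exact: sumr_ge0.
elim=> [|k IHk] i.
  by rewrite expr0 mul1mx mulr1 (bigD1 i) //= lerDl sumr_ge0.
rewrite exprS -mulmxA mxE (le_trans (ler_norm_sum _ _ _)) //.
rewrite exprS mulrCA [X in _ <= X * _](bigD1 i) //= mulrDl ler_wpDr //.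
  by rewrite mulr_ge0 ?mulr_ge0 ?exprn_ge0 // ?sumr_ge0 // => ? _; rewrite sumr_ge0.
rewrite mulr_suml ler_sum // => j _; by rewrite normrM ler_wpM2l.
Qed.

Lemma is_cvg_expmx_coeff a i (t : R) : cvgn (pseries (expmx_coeff a i) t).
Proof.
have [r [C [r_ge0 C_ge0 bound]]] := expmx_coeff_bound a.
apply: normed_cvg.
apply: (@series_le_cvg _ _ (C *: exp_coeff (r * `|t|))) => [k|k|k|] /=.
- exact: normr_ge0.
- by rewrite mulr_ge0 // divr_ge0 // exprn_ge0 // mulr_ge0.
- rewrite /expmx_coeff !normrM normfV normrX (ger0_norm (ler0n _ _)).
  have -> : (C *: exp_coeff (r * `|t|)) k = C * r ^+ k / k`!%:R * `|t| ^+ k.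
    by rewrite -[LHS]/(C * ((r * `|t|) ^+ k / k`!%:R)) exprMn; ring.
  by rewrite ler_wpM2r ?exprn_ge0 // ler_wpM2r ?invr_ge0.
- exact/is_cvg_seriesZ/is_cvg_series_exp_coeff.
Qed.

(** Differentiating the exponential series amounts to applying A to the initial
vector. *)
Lemma pseries_diffs_expmx_coeff a i :
  pseries_diffs (expmx_coeff a i) = expmx_coeff (A *m a) i.
Proof.
apply/funext => k; rewrite /pseries_diffs /expmx_coeff exprSr -mulmxA factS natrM.
by rewrite invfM mulrCA mulVKf // pnatr_eq0.
Qed.

Definition free_motion (a : 'cV[R]_n) (t : R) : 'cV[R]_n :=
  \col_i limn (pseries (expmx_coeff a i) t).

Lemma free_motion0 a : free_motion a 0 = a.
Proof.
apply/matrixP => i j; rewrite (ord1 j) mxE; apply: cvg_lim => //.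
rewrite -(cvg_shiftS _); apply: cvg_near_cst; near=> N.
rewrite /pseries /series /= big_nat_recl // expr0 mulr1 big1 ?addr0.
  by rewrite /expmx_coeff expr0 mul1mx fact0 divr1.
by move=> k _; rewrite expr0n mulr0.
Unshelve. all: by end_near. Qed.

Lemma free_motion_mulmx a t : free_motion (A *m a) t = A *m free_motion a t.
Proof.
apply/matrixP => i j; rewrite (ord1 j) !mxE; apply: cvg_lim => //.
have -> : pseries (expmx_coeff (A *m a) i) t =
    (fun N => \sum_j A i j * pseries (expmx_coeff a j) t N).
  apply/funext => N; rewrite /pseries /series /=.
  under [RHS]eq_bigr do rewrite mulr_sumr.
  rewrite exchange_big; apply: eq_bigr => k _ /=.
  rewrite /expmx_coeff mulmxA -[A ^+ k *m A]/(A ^+ k * A) -exprSr exprS.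
  rewrite -mulmxA mxE !mulr_suml.
  by apply: eq_bigr => l _; rewrite !mulrA.
apply: cvg_big => [|l _]; first exact: add_continuous.
rewrite mxE; apply: cvgM; first exact: cvg_cst.
exact: is_cvg_expmx_coeff.
Qed.

Lemma is_derive_free_motion a (t : R) i :
  is_derive t (1 : R) (fun s => free_motion a s i 0) ((A *m free_motion a t) i 0).
Proof.
have -> : (fun s => free_motion a s i 0) = (fun s => limn (pseries (expmx_coeff a i) s)).
  by apply/funext => s; rewrite mxE.
rewrite -free_motion_mulmx mxE -pseries_diffs_expmx_coeff.
apply: (@pseries_snd_diffs _ _ (`|t| + 1)); rewrite ?pseries_diffs_expmx_coeff;
  try exact: is_cvg_expmx_coeff.
by rewrite [ltRHS]ger0_norm ?ltrDl.
Qed.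

End FreeMotion.

(** * Herdability *)

Lemma poly_reach_herdable (R : realType) (n m : nat) (A : 'M[R]_n)
    (B : 'M[R]_(n, m)) z :
  poly_reach A B z -> (forall i, 0 < z i 0) -> ct_herdable A B.
Proof.
move=> [x [u [dx x0 x1]]] z_pos a h _.
have [c _ c_large] := large_multiple (P := xpredT)
  (fun i => h - free_motion A a 1 i 0) (fun i _ => z_pos i).
pose X t := c *: (\col_i (x i).[t]) + free_motion A a t.
pose U t : 'cV[R]_m := c *: (\col_j (u j).[t]).
have dX (t : R) i :
    is_derive t (1 : R) (fun s => X s i 0) ((A *m X t + B *m U t) i 0).
  have -> : (fun s => X s i 0) =
      horner (c *: x i) + (fun s => free_motion A a s i 0).
    by apply/funext => s; rewrite scale_addmxE mxE [RHS]/= fctE hornerZ.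
  have -> : (A *m X t + B *m U t) i 0 =
      (c *: x i)^`().[t] + (A *m free_motion A a t) i 0.
    rewrite derivZ dx hornerZ hornerD !horner_sum /X /U mulmxDr -!scalemxAr.
    rewrite addrAC -scalerDr scale_addmxE; congr (c * _ + _).
    rewrite mxE; congr (_ + _); rewrite mxE; apply: eq_bigr => j _;
      by rewrite mxE hornerZ.
  by apply: is_deriveD; exact: is_derive_free_motion.
exists 1, U, X; split=> //.
- split=> [j|i|t i _]; last exact: dX.
  + apply: continuous_subspaceT.
    have -> : (fun s => U s j 0) = horner (c *: u j).
      by apply/funext => s; rewrite !mxE hornerZ.
    exact: continuous_horner.
  + apply: continuous_subspaceT => t.
    apply/differentiable_continuous/derivable1_diffP.
    exact: (@ex_derive _ _ _ _ _ _ _ (dX t i)).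
- rewrite /X free_motion0 [X in c *: X](_ : _ = 0) ?scaler0 ?add0r //.
  by apply/matrixP => i j; rewrite !mxE x0.
- by move=> i; rewrite scale_addmxE mxE x1 -lerBlDr ltW // c_large.
Qed.

Theorem proposition6 (R : realType) (n m K : nat) (A : 'M[R]_n)
    (B : 'M[R]_(n, m)) (mn : (m <= n)%N)
    (defB : B = pid_mx m)
    (lf : leader_follower A m K)
    (no_zero_row : forall k, (1 <= k <= K)%N ->
       forall h, row h (Phi A B k) != 0)
    (herd : forall k, (1 <= k <= K)%N ->
       forall h, h \notin unisigned_rows (Phi A B k) ->
       exists i, [/\ i \notin unisigned_cols (Phi A B k),
         Phi A B k h i != 0 &
         forall l, l \notin unisigned_rows (Phi A B k) ->
           Phi A B k l i != 0 ->
           Num.sg (Phi A B k l i) = Num.sg (Phi A B k h i)]) :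
  ct_herdable A B /\ dt_herdable A B.
Proof.
have Phi_pos k : (1 <= k <= K)%N ->
    exists v : 'cV_m, forall h, 0 < (Phi A B k *m v) h 0.
  by move=> kK; apply: positive_combination; exact: herd.
have positive V := controllability_positive (V := V) mn defB lf Phi_pos.
split.
  have [|k w _|z [Vz z_pos]] := positive (poly_reach A B).
  - exact: linear_poly_reach.
  - exact: poly_reach_power.
  - exact: poly_reach_herdable Vz z_pos.
have [|k w kK|z [Vz z_pos]] := positive (dt_reach A B K.+1).
- exact: linear_dt_reach.
- exact: dt_reach_power.
- exact: dt_reach_herdable Vz z_pos.
Qed.
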